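(* Let $j\in N$. Algorithm 1 (described in the context) correctly solves, in $\mathcal{O}(n\log n)$ time, the separation problem for the families of inequalities $(\mathrm{Under}_S)$ and $(\mathrm{Over}_S)$, $S\subseteq N\setminus\{j\}$. That is, given any $\bar x_j\in[0,1]$ and $(\bar y_0,\bar{\boldsymbol{y}})\in Y$, in time $\mathcal{O}(n\log n)$ it either correctly reports that $(\bar x_j,\bar y_0,\bar{\boldsymbol{y}})$ satisfies $(\mathrm{Under}_S)$ and $(\mathrm{Over}_S)$ for all $S\subseteq N\setminus\{j\}$, or returns one of these inequalities that is violated at $(\bar x_j,\bar y_0,\bar{\boldsymbol{y}})$.
   Context: $N=\{1,\dots,n\}$; $u_0>0$ and $u_k\ge0$ for $k\in N$ are given. For $S\subseteq N$, $\alpha(S)=1/(u_0+\sum_{i\in S}u_i)$. Let $$Y=\Bigl\{(y_0,\boldsymbol{y})\in\mathbb{R}^{n+1}: u_0y_0+\sum_{k\in N}u_ky_k=1,\ 0\le y_k\le y_0\text{ for all }k\in N\Bigr\}.$$ For $S\subseteq N\setminus\{j\}$ consider the inequalities in $(x_j,y_0,\boldsymbol{y})$ $$(\mathrm{Under}_S)\quad y_j\ge \alpha(S\cup\{j\})x_j-\sum_{t\in N\setminus(S\cup\{j\})}u_t\,\alpha(S\cup\{j\})\,y_t,$$ $$(\mathrm{Over}_S)\quad y_j\le \alpha(S\cup\{j\})x_j+\bigl(1-(u_0+u_j)\alpha(S\cup\{j\})\bigr)y_0-\sum_{t\in S}u_t\,\alpha(S\cup\{j\})\,y_t.$$ Algorithm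 1. Input: $\bar x_j\in[0,1]$, $(\bar y_0,\bar{\boldsymbol{y}})\in Y$. (1) Find an ordering $\sigma(1),\dots,\sigma(n-1)$ of $N\setminus\{j\}$ with $\bar y_{\sigma(1)}\ge\cdots\ge\bar y_{\sigma(n-1)}$. (2) Let $S^*=\{t\in N\setminus\{j\}:\bar y_t\ge\bar y_j\}$ (an initial segment $\{\sigma(1),\dots,\sigma(k)\}$ of this ordering). (3) Let $T^*=\{t\in N\setminus\{j\}:\bar y_t\ge\bar y_0-\bar y_j\}$ (also an initial segment). (4) If the point satisfies both $(\mathrm{Under}_{S^*})$ and $(\mathrm{Over}_{T^*})$, report that it satisfies all inequalities $(\mathrm{Under}_S)$ and $(\mathrm{Over}_S)$; otherwise return whichever of $(\mathrm{Under}_{S^*})$, $(\mathrm{Over}_{T^*})$ is violated. Running time counts elementary arithmetic operations and comparisons. *)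

(* Defs.v *)
From mathcomp Require Import all_boot all_order all_algebra.
From mathcomp Require Import all_classical all_reals all_analysis.

Set Implicit Arguments.
Unset Strict Implicit.
Unset Printing Implicit Defensive.

Import Order.TTheory GRing.Theory Num.Theory.
Import numFieldNormedType.Exports.
Local Open Scope classical_set_scope.
Local Open Scope ring_scope.

(* The index set N = {1, ..., n} is 'I_n. *)

Definition alpha (R : realType) (n : nat) (u0 : R) (u : 'I_n -> R)
    (S : {set 'I_n}) : R :=
  1 / (u0 + \sum_(i in S) u i).

Definition Y (R : realType) (n : nat) (u0 : R) (u : 'I_n -> R) :
    set (R * ('I_n -> R)) :=
  [set p | u0 * p.1 + \sum_k u k * p.2 k = 1 /\
           forall k, 0 <= p.2 k <= p.1].

Definition under_ineq (R : realType) (n : nat) (j : 'I_n) (u0 : R)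
    (u : 'I_n -> R) (S : {set 'I_n}) (xj y0 : R) (y : 'I_n -> R) : Prop :=
  y j >= alpha u0 u (j |: S) * xj
         - \sum_(t in ~: (j |: S)) u t * alpha u0 u (j |: S) * y t.

Definition over_ineq (R : realType) (n : nat) (j : 'I_n) (u0 : R)
    (u : 'I_n -> R) (S : {set 'I_n}) (xj y0 : R) (y : 'I_n -> R) : Prop :=
  y j <= alpha u0 u (j |: S) * xj
         + (1 - (u0 + u j) * alpha u0 u (j |: S)) * y0
         - \sum_(t in S) u t * alpha u0 u (j |: S) * y t.

Inductive inequality (n : nat) : Type :=
| Under of {set 'I_n}
| Over of {set 'I_n}.

Arguments Under {n}.
Arguments Over {n}.

Definition index_of (n : nat) (q : inequality n) : {set 'I_n} :=
  match q with Under s => s | Over s => s end.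

Definition satisfies (R : realType) (n : nat) (j : 'I_n) (u0 : R)
    (u : 'I_n -> R) (xj y0 : R) (y : 'I_n -> R) (q : inequality n) : Prop :=
  match q with
  | Under s => under_ineq j u0 u s xj y0 y
  | Over s => over_ineq j u0 u s xj y0 y
  end.

(* [None] is the report "all the inequalities hold"; [Some q] returns [q]. *)
Definition separates (R : realType) (n : nat) (j : 'I_n) (u0 : R)
    (u : 'I_n -> R) (xj y0 : R) (y : 'I_n -> R)
    (answer : option (inequality n)) : Prop :=
  match answer with
  | None =>
      forall S : {set 'I_n}, S \subset [set~ j] ->
        under_ineq j u0 u S xj y0 y /\ over_ineq j u0 u S xj y0 y
  | Some q =>
      index_of q \subset [set~ j] /\ ~ satisfies j u0 u xj y0 y q
  end.

(* Programs whose numbers have type V.  An algorithm is a program defined for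
   every V, so the only way it can compute with its numerical data, or branch
   on them, is through the constructors below, each of which is charged one
   unit, except for [Ret] and the constant [One].  Bookkeeping on indices and
   lists of indices is not charged. *)
Inductive operation := Opadd | Opsub | Opmul | Opdiv.

Inductive program (V A : Type) : Type :=
| Ret of A
| One of (V -> program V A)
| Arith of operation & V & V & (V -> program V A)
| Test_le of V & V & (bool -> program V A).

Arguments Ret {V A}.
Arguments One {V A}.
Arguments Arith {V A}.
Arguments Test_le {V A}.

Fixpoint bind (V A B : Type) (m : program V A) (k : A -> program V B) :
    program V B :=
  match m with
  | Ret a => k a
  | One f => One (fun v => bind (f v) k)
  | Arith o v w f => Arith o v w (fun z => bind (f z) k)
  | Test_le v w f => Test_le v w (fun b => bind (f b) k)
  end.

Notation "'let!' x := m 'in' k" := (bind m (fun x => k))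
  (at level 200, x name, m at level 200, k at level 200).

Definition one (V : Type) : program V V := One Ret.
Definition add (V : Type) (v w : V) : program V V := Arith Opadd v w Ret.
Definition sub (V : Type) (v w : V) : program V V := Arith Opsub v w Ret.
Definition mul (V : Type) (v w : V) : program V V := Arith Opmul v w Ret.
Definition div (V : Type) (v w : V) : program V V := Arith Opdiv v w Ret.
Definition test_le (V : Type) (v w : V) : program V bool := Test_le v w Ret.

Arguments one {V}.

Definition apply_op (R : realType) (o : operation) (v w : R) : R :=
  match o with
  | Opadd => v + w
  | Opsub => v - w
  | Opmul => v * w
  | Opdiv => v / w
  end.

Fixpoint result (R : realType) (A : Type) (m : program R A) : A :=
  match m with
  | Ret a => a
  | One f => result (f 1)
  | Arith o v w f => result (f (apply_op o v w))
  | Test_le v w f => result (f (v <= w))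
  end.

Fixpoint cost (R : realType) (A : Type) (m : program R A) : nat :=
  match m with
  | Ret _ => 0%N
  | One f => cost (f 1)
  | Arith o v w f => (cost (f (apply_op o v w))).+1
  | Test_le v w f => (cost (f (v <= w))).+1
  end.

Fixpoint foldM (V A I : Type) (f : A -> I -> program V A) (a : A)
    (s : seq I) : program V A :=
  match s with
  | [::] => Ret a
  | t :: s' => let! b := f a t in foldM f b s'
  end.

Fixpoint merge_desc (V I : Type) (y : I -> V) (s1 : seq I) :
    seq I -> program V (seq I) :=
  match s1 with
  | [::] => fun s2 => Ret s2
  | a :: s1' =>
      fix merge_a (s2 : seq I) : program V (seq I) :=
        match s2 with
        | [::] => Ret s1
        | b :: s2' =>
            let! a_first := test_le (y b) (y a) in
            if a_first then
              let! s := merge_desc y s1' s2 in Ret (a :: s)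
            else
              let! s := merge_a s2' in Ret (b :: s)
        end
  end.

Fixpoint merge_sort_rec (V I : Type) (y : I -> V) (fuel : nat) (s : seq I) :
    program V (seq I) :=
  match fuel with
  | 0 => Ret s
  | fuel'.+1 =>
      if (size s <= 1)%N then Ret s else
      let! s1 := merge_sort_rec y fuel' (take (size s)./2 s) in
      let! s2 := merge_sort_rec y fuel' (drop (size s)./2 s) in
      merge_desc y s1 s2
  end.

(* Recursive calls are on strictly shorter lists, so the bound [size s] on the
   recursion depth is never reached. *)
Definition sort_desc (V I : Type) (y : I -> V) (s : seq I) :
    program V (seq I) :=
  merge_sort_rec y (size s) s.

(* The longest initial segment of s on which y t >= c, with what remains.  On a
   list ordered by decreasing y this segment is {t | y t >= c}. *)
Fixpoint split_ge (V I : Type) (y : I -> V) (c : V) (s : seq I) :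
    program V (seq I * seq I) :=
  match s with
  | [::] => Ret ([::], [::])
  | t :: s' =>
      let! keep := test_le c (y t) in
      if keep then
        let! p := split_ge y c s' in Ret (t :: p.1, p.2)
      else Ret ([::], s)
  end.

Definition compute_alpha (V : Type) (n : nat) (j : 'I_n) (u0 : V)
    (u : 'I_n -> V) (s : seq 'I_n) : program V V :=
  let! d0 := add u0 (u j) in
  let! d := foldM (fun d i => add d (u i)) d0 s in
  let! i := one in
  div i d.

Definition subtract_terms (V : Type) (n : nat) (u : 'I_n -> V) (a : V)
    (y : 'I_n -> V) (b : V) (s : seq 'I_n) : program V V :=
  foldM (fun c t => let! w := mul (u t) a in
                    let! z := mul w (y t) in
                    sub c z) b s.

(* [s] lists S, [r] lists the complement of j |: S. *)
Definition test_under (V : Type) (n : nat) (j : 'I_n) (u0 : V) (u : 'I_n -> V)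
    (s r : seq 'I_n) (xj : V) (y : 'I_n -> V) : program V bool :=
  let! a := compute_alpha j u0 u s in
  let! b := mul a xj in
  let! rhs := subtract_terms u a y b r in
  test_le rhs (y j).

Definition test_over (V : Type) (n : nat) (j : 'I_n) (u0 : V) (u : 'I_n -> V)
    (s : seq 'I_n) (xj y0 : V) (y : 'I_n -> V) : program V bool :=
  let! a := compute_alpha j u0 u s in
  let! b := mul a xj in
  let! v := add u0 (u j) in
  let! va := mul v a in
  let! i := one in
  let! c := sub i va in
  let! cy0 := mul c y0 in
  let! d := add b cy0 in
  let! rhs := subtract_terms u a y d s in
  test_le (y j) rhs.

Definition algorithm1 (n : nat) (j : 'I_n) (V : Type) (u0 : V) (u : 'I_n -> V)
    (xj y0 : V) (y : 'I_n -> V) : program V (option (inequality n)) :=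
  let! sigma := sort_desc y [seq t <- enum 'I_n | t != j] in
  let! Sstar := split_ge y (y j) sigma in
  let! c := sub y0 (y j) in
  let! Tstar := split_ge y c sigma in
  let! under_ok := test_under j u0 u Sstar.1 Sstar.2 xj y in
  let! over_ok := test_over j u0 u Tstar.1 xj y0 y in
  Ret (if ~~ under_ok then Some (Under [set t in Sstar.1])
       else if ~~ over_ok then Some (Over [set t in Tstar.1])
       else None).

(* Main.v *)
Require Import Defs.
From mathcomp Require Import all_boot all_order all_algebra.
From mathcomp Require Import all_classical all_reals all_analysis.
From mathcomp Require Import zify ring lra.
Set Implicit Arguments.
Unset Strict Implicit.
Unset Printing Implicit Defensive.
Import Order.TTheory GRing.Theory Num.Theory.
Import numFieldNormedType.Exports.
Local Open Scope classical_set_scope.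
Local Open Scope ring_scope.

(** Multiply an inequality indexed by S by the positive number
    [u0 + u j + \sum_(t in S) u t], the inverse of alpha (j |: S).  It becomes a
    comparison of [xj] with a sum over the indices t other than j in which the
    membership of t in S affects the term of t only:
    - (Under_S) reads
      [xj <= (u0 + u j) * y j
             + \sum_(t != j) u t * (if t \in S then y j else y t)],
    - (Over_S) reads
      [(u0 + u j) * y j + \sum_(t in S) u t * (y j + y t - y0) <= xj].
    The strongest inequality of each family is therefore found term by term.  As
    [u t >= 0], the first right-hand side is smallest when S consists of the t
    with [y j <= y t], and the second left-hand side is largest when S consists
    of the t with [y0 - y j <= y t].  These are the two sets that the algorithm
    tests ([under_strongest], [over_strongest]), so a point satisfying both
    inequalities satisfies both families.

    For the program, sorting makes each of the two sets an initial segment of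
    the list ([result_split_ge]), and the tests evaluate the inequalities as
    written ([test_underP], [test_overP]).  Merging makes at most one comparison
    per element, so by halving a list of length at most [2 ^ k] is sorted with
    at most k comparisons per element ([cost_merge_sort_rec]).  All the other
    phases are linear, which gives a cost of at most [15 * n * k] with
    [k = trunc_log 2 n + 1], and k is O(ln n) ([trunc_log_le_ln]). *)

(** * Semantics of programs *)

Section Programs.
Context {R : realType}.

Lemma result_bind (A B : Type) (m : program R A) (k : A -> program R B) :
  result (bind m k) = result (k (result m)).
Proof. by elim: m => //= [f IH|o v w f IH|v w f IH]; rewrite IH. Qed.

Lemma cost_bind (A B : Type) (m : program R A) (k : A -> program R B) :
  cost (bind m k) = (cost m + cost (k (result m)))%N.
Proof.
by elim: m => [a|f IH|o v w f IH|v w f IH] /=; rewrite ?add0n ?IH ?addSn.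
Qed.

Lemma result_foldM (A I : Type) (f : A -> I -> program R A) a s :
  result (foldM f a s) = foldl (fun b t => result (f b t)) a s.
Proof. by elim: s a => //= t s IH a; rewrite result_bind IH. Qed.

Lemma cost_foldM (A I : Type) (f : A -> I -> program R A) c a s :
  (forall b t, cost (f b t) = c) -> cost (foldM f a s) = (c * size s)%N.
Proof.
move=> fc; elim: s a => [|t s IH] a /=; first by rewrite muln0.
by rewrite cost_bind fc IH mulnS.
Qed.

(** * Sorting *)

Section Sorting.
Context {I : eqType} (y : I -> R).

Definition ge_on : rel I := [rel a b | y b <= y a].

Lemma ge_on_total : total ge_on.
Proof. by move=> a b /=; apply: le_total. Qed.

Lemma ge_on_trans : transitive ge_on.
Proof. by move=> b a c /= ab bc; apply: le_trans bc ab. Qed.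

Lemma result_merge_desc s1 s2 :
  result (merge_desc y s1 s2) = merge ge_on s1 s2.
Proof.
elim: s1 s2 => [//|a s1 IH1]; elim=> [//|b s2 IH2] /=.
rewrite -[y b <= y a]/(ge_on a b); case: ifP => _; rewrite result_bind /=.
  by rewrite IH1.
by congr (_ :: _); exact: IH2.
Qed.

Lemma cost_merge_desc s1 s2 :
  (cost (merge_desc y s1 s2) <= size s1 + size s2)%N.
Proof.
elim: s1 s2 => [//|a s1 IH1]; elim=> [//|b s2 IH2] /=.
case: ifP => _; rewrite cost_bind /= addn0.
  by rewrite addSn ltnS; apply: IH1.
by rewrite addnS ltnS; apply: IH2.
Qed.

Lemma perm_merge_sort_rec fuel s :
  perm_eq (result (Defs.merge_sort_rec y fuel s)) s.
Proof.
elim: fuel s => [|fuel IH] s //=; case: ifP => // _.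
rewrite !result_bind result_merge_desc perm_merge.
by rewrite -[X in perm_eq _ X](cat_take_drop (size s)./2) perm_cat.
Qed.

Lemma sorted_merge_sort_rec fuel s :
  (size s <= fuel)%N -> sorted ge_on (result (Defs.merge_sort_rec y fuel s)).
Proof.
elim: fuel s => [|fuel IH] s /=; first by case: s.
case: ifP => [|/negbT s1 sf]; first by case: s => [|a []].
rewrite !result_bind result_merge_desc.
by apply: (merge_sorted ge_on_total); apply: IH;
   rewrite ?size_drop ?size_takel; lia.
Qed.

(** Each level of the recursion makes at most one comparison per element, and
    the bound [2 ^ k] on the length is halved from one level to the next. *)
Lemma cost_merge_sort_rec fuel k s :
  (size s <= 2 ^ k)%N -> (cost (Defs.merge_sort_rec y fuel s) <= size s * k)%N.
Proof.
elim: k fuel s => [|k IH] [|fuel] s //=; case: ifP => //= /negbT.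
rewrite expnS => s1 sk.
set s' := take _ s; set s'' := drop _ s.
have ss : (size s' + size s'' = size s)%N by rewrite -size_cat cat_take_drop.
have /(IH fuel) c' : (size s' <= 2 ^ k)%N by rewrite size_takel; lia.
have /(IH fuel) c'' : (size s'' <= 2 ^ k)%N by rewrite size_drop; lia.
rewrite !cost_bind.
have := cost_merge_desc (result (Defs.merge_sort_rec y fuel s'))
                        (result (Defs.merge_sort_rec y fuel s'')).
rewrite !(perm_size (perm_merge_sort_rec _ _)) => cm.
by rewrite mulnS -ss mulnDl; lia.
Qed.

(** On a list sorted by decreasing y, an element that fails the test is followed
    only by elements that fail it, so stopping there loses nothing. *)
Lemma result_split_ge c s : sorted ge_on s ->
  result (split_ge y c s) =
  ([seq t <- s | c <= y t], [seq t <- s | ~~ (c <= y t)]).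
Proof.
elim: s => [|t s IH] //= ts.
case: ifPn => [_|ct]; first by rewrite result_bind IH ?(path_sorted ts).
have small : all (fun i => ~~ (c <= y i)) s.
  apply: sub_all (order_path_min ge_on_trans ts) => i /= it.
  by apply: contra ct => /le_trans; apply.
rewrite /= (all_filterP small); congr (_, _).
by apply/esym/eqP; rewrite -(negbK (_ == _)) -has_filter -all_predC.
Qed.

Lemma cost_split_ge c s : (cost (split_ge y c s) <= size s)%N.
Proof.
by elim: s => [|t s IH] //=; case: ifP => // _; rewrite cost_bind addn0.
Qed.

End Sorting.

(** * The strongest inequality of each family *)

Section Inequalities.
Context {n : nat} (j : 'I_n) (u0 : R) (u : 'I_n -> R).
Hypotheses (u0_gt0 : 0 < u0) (u_ge0 : forall k, 0 <= u k).
Variables (xj y0 : R) (y : 'I_n -> R).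
Implicit Type S : {set 'I_n}.

(** The complement of j that bounds the index sets of the two families is a
    classical set, whose membership is not computational. *)
Lemma subset_setC1 S : (S \subset [set~ j]) = (j \notin S).
Proof.
apply/fintype.subsetP/idP => [sub|jS t tS].
  by apply/negP => /sub; rewrite inE => /(_ erefl).
by rewrite inE => /= tj; rewrite -tj tS in jS.
Qed.

Lemma alphaE S : j \notin S ->
  alpha u0 u (j |: S) = (u0 + u j + \sum_(t in S) u t)^-1.
Proof. by move=> jS; rewrite /alpha div1r big_setU1 //= addrA. Qed.

Lemma denom_gt0 S : 0 < u0 + u j + \sum_(t in S) u t.
Proof. by rewrite -addrA ltr_pwDl // addr_ge0 // sumr_ge0. Qed.

Lemma sum_setE S (F : 'I_n -> R) : j \notin S ->
  \sum_(t in S) F t = \sum_(t | t != j) (if t \in S then F t else 0).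
Proof.
move=> jS; rewrite -big_mkcondr; apply: eq_bigl => t.
by case: eqP => // ->; apply: negbTE.
Qed.

(** Both members are multiplied by the positive denominator D of alpha (j |: S).
    The coefficient D of [y j] contains [u t] for each t in S, and the terms
    [u t * y t] with t outside S move to the same side. *)
Lemma under_ineqE S : j \notin S ->
  under_ineq j u0 u S xj y0 y <->
  xj <= (u0 + u j) * y j
        + \sum_(t | t != j) u t * (if t \in S then y j else y t).
Proof.
move=> jS; rewrite /under_ineq (alphaE jS).
set D := _ + \sum_(t in S) _; have D0 : 0 < D := denom_gt0 S.
have -> : \sum_(t in ~: (j |: S)) u t * D^-1 * y t
    = D^-1 * \sum_(t | t != j) (if t \in S then 0 else u t * y t).
  rewrite mulr_sumr [RHS](eq_bigr
    (fun t => if t \notin S then u t * D^-1 * y t else 0)).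
    by rewrite -big_mkcondr; apply: eq_bigl => t; rewrite !inE negb_or.
  by move=> t _; case: (t \in S) => /=; ring.
rewrite -mulrBr ler_pdivrMl // lerBlDr.
rewrite /D mulrDl mulr_suml (sum_setE _ jS) -addrA -big_split /=.
rewrite (eq_bigr (fun t => u t * (if t \in S then y j else y t))) //.
by move=> t _; case: ifP => _; rewrite ?addr0 ?add0r.
Qed.

(** After multiplication by the same D, the coefficient of [y0] becomes
    [D - (u0 + u j)], which is the sum of the [u t] over S, so [y j], [y0] and
    [y t] come together with the common factor [u t]. *)
Lemma over_ineqE S : j \notin S ->
  over_ineq j u0 u S xj y0 y <->
  (u0 + u j) * y j
    + \sum_(t | t != j) (if t \in S then u t * (y j + y t - y0) else 0) <= xj.
Proof.
move=> jS; rewrite /over_ineq (alphaE jS) -(sum_setE _ jS).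
have D0 := denom_gt0 S.
have -> : \sum_(t in S) u t * (y j + y t - y0) =
    (\sum_(t in S) u t) * (y j - y0) + \sum_(t in S) u t * y t.
  by rewrite mulr_suml -big_split /=; apply: eq_bigr => t _; ring.
have -> (a : R) : \sum_(t in S) u t * a * y t = a * \sum_(t in S) u t * y t.
  by rewrite mulr_sumr; apply: eq_bigr => t _; ring.
move: D0; set U := \sum_(t in S) u t; set W := \sum_(t in S) _ => D0.
set D := u0 + u j + U in D0 *.
have -> : D^-1 * xj + (1 - (u0 + u j) * D^-1) * y0 - D^-1 * W
    = D^-1 * (xj + U * y0 - W).
  have -> : u0 + u j = D - U by rewrite /D addrK.
  by field; apply: lt0r_neq0.
rewrite ler_pdivlMl // /D.
by split => h; lra.
Qed.

(** In [under_ineqE] the term of t is [u t * y j] or [u t * y t], according to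
    whether t is in the index set; the test [y j <= y t] that defines [Sstar]
    selects the smaller of the two. *)
Lemma under_strongest (Sstar S : {set 'I_n}) :
  j \notin Sstar -> j \notin S ->
  (forall t, t != j -> (t \in Sstar) = (y j <= y t)) ->
  under_ineq j u0 u Sstar xj y0 y -> under_ineq j u0 u S xj y0 y.
Proof.
move=> jSstar jS SstarE /(under_ineqE jSstar) h; apply/(under_ineqE jS).
apply: (le_trans h); rewrite lerD2l; apply: ler_sum => t tj.
rewrite ler_wpM2l // SstarE //.
by case: (leP (y j) (y t)) => yt; case: ifP => // _; apply: ltW.
Qed.

(** In [over_ineqE] the index t contributes [u t * (y j + y t - y0)] or 0; the
    test [y0 - y j <= y t] that defines [Tstar] says that the bracket is
    nonnegative, so that it selects the larger of the two. *)
Lemma over_strongest (Tstar S : {set 'I_n}) :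
  j \notin Tstar -> j \notin S ->
  (forall t, t != j -> (t \in Tstar) = (y0 - y j <= y t)) ->
  over_ineq j u0 u Tstar xj y0 y -> over_ineq j u0 u S xj y0 y.
Proof.
move=> jT jS TE /(over_ineqE jT) h; apply/(over_ineqE jS).
apply: le_trans h; rewrite lerD2l; apply: ler_sum => t tj.
have ut := u_ge0 t.
rewrite TE //; case: (leP (y0 - y j) (y t)) => yt; case: ifP => // _.
  by rewrite mulr_ge0 //; lra.
by rewrite mulr_ge0_le0 //; lra.
Qed.

(** * Evaluation of the two inequalities *)

Lemma sum_seq_set (s : seq 'I_n) (F : 'I_n -> R) : uniq s ->
  \sum_(t <- s) F t = \sum_(t in [set t in s]%SET) F t.
Proof. by move=> us; rewrite big_uniq //; apply: eq_bigl => t; rewrite inE. Qed.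

Lemma result_compute_alpha s : uniq s -> j \notin s ->
  result (compute_alpha j u0 u s) = alpha u0 u (j |: [set t in s]).
Proof.
move=> us js; rewrite alphaE ?inE // -sum_seq_set //.
rewrite /compute_alpha /= result_bind result_foldM /= div1r; congr (_^-1).
elim: s (u0 + u j) {us js} => [|t s IH] d /=; first by rewrite big_nil addr0.
by rewrite IH big_cons addrA.
Qed.

Lemma cost_compute_alpha s : cost (compute_alpha j u0 u s) = (size s).+2.
Proof. by rewrite /compute_alpha /= cost_bind (@cost_foldM _ _ _ 1) //=; lia. Qed.

Lemma result_subtract_terms a b s :
  result (subtract_terms u a y b s) = b - \sum_(t <- s) u t * a * y t.
Proof.
rewrite /subtract_terms result_foldM /=.
elim: s b => [|t s IH] b /=; first by rewrite big_nil subr0.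
by rewrite IH big_cons; ring.
Qed.

Lemma cost_subtract_terms a b s :
  cost (subtract_terms u a y b s) = (3 * size s)%N.
Proof. exact: cost_foldM. Qed.

Lemma test_underP s r : uniq s -> uniq r -> j \notin s ->
  r =i [predC j :: s] ->
  reflect (under_ineq j u0 u [set t in s] xj y0 y)
          (result (test_under j u0 u s r xj y)).
Proof.
move=> us ur js rE.
rewrite /test_under result_bind result_compute_alpha //= result_bind /=.
rewrite result_subtract_terms /under_ineq sum_seq_set //.
have -> : [set t in r]%SET = ~: (j |: [set t in s]%SET).
  by apply/finset.setP => t; rewrite !inE rE !inE.
exact: idP.
Qed.

Lemma cost_test_under s r :
  cost (test_under j u0 u s r xj y) = (size s + 3 * size r + 4)%N.
Proof.
rewrite /test_under cost_bind cost_compute_alpha /= cost_bind.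
by rewrite cost_subtract_terms /=; lia.
Qed.

Lemma test_overP s : uniq s -> j \notin s ->
  reflect (over_ineq j u0 u [set t in s] xj y0 y)
          (result (test_over j u0 u s xj y0 y)).
Proof.
move=> us js.
rewrite /test_over result_bind result_compute_alpha //= result_bind /=.
rewrite result_subtract_terms /over_ineq sum_seq_set //.
exact: idP.
Qed.

Lemma cost_test_over s :
  cost (test_over j u0 u s xj y0 y) = (4 * size s + 9)%N.
Proof.
rewrite /test_over cost_bind cost_compute_alpha /= cost_bind.
by rewrite cost_subtract_terms /=; lia.
Qed.

(** * Correctness and cost of the algorithm *)

Lemma size_filter_neq : size [seq t <- enum 'I_n | t != j] = n.-1.
Proof.
by rewrite -rem_filter ?enum_uniq // size_rem ?mem_enum // size_enum_ord.
Qed.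

Lemma algorithm1_separates :
  separates j u0 u xj y0 y (result (algorithm1 j u0 u xj y0 y)).
Proof.
rewrite /algorithm1 result_bind.
set sigma := result (sort_desc _ _).
have psigma : perm_eq sigma [seq t <- enum 'I_n | t != j].
  exact: perm_merge_sort_rec.
have ssigma : sorted (ge_on y) sigma by apply: sorted_merge_sort_rec.
have usigma : uniq sigma by rewrite (perm_uniq psigma) filter_uniq ?enum_uniq.
have sigmaE t : (t \in sigma) = (t != j).
  by rewrite (perm_mem psigma) mem_filter mem_enum andbT.
clearbody sigma.
rewrite result_bind result_split_ge // result_bind.
rewrite -[result (Defs.sub _ _)]/(y0 - y j) result_bind result_split_ge //.
rewrite 2!result_bind /fst /snd.
set s := [seq t <- sigma | y j <= y t].
set r := [seq t <- sigma | ~~ (y j <= y t)].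
set s' := [seq t <- sigma | y0 - y j <= y t].
have sE t : t != j -> (t \in [set t in s]%SET) = (y j <= y t).
  by move=> tj; rewrite inE mem_filter sigmaE tj andbT.
have s'E t : t != j -> (t \in [set t in s']%SET) = (y0 - y j <= y t).
  by move=> tj; rewrite inE mem_filter sigmaE tj andbT.
have js : j \notin s by rewrite mem_filter sigmaE eqxx andbF.
have js' : j \notin s' by rewrite mem_filter sigmaE eqxx andbF.
have rE : r =i [predC j :: s].
  move=> t; rewrite !inE !mem_filter sigmaE.
  by case: (t == j); rewrite ?andbF ?andbT.
have sC : j \notin [set t in s]%SET by rewrite inE.
have s'C : j \notin [set t in s']%SET by rewrite inE.
have [us ur us'] : [/\ uniq s, uniq r & uniq s'] by split; apply: filter_uniq.
case: (test_underP us ur js rE) => [under_ok|under_fail]; last first.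
  by split; rewrite ?subset_setC1.
case: (test_overP us' js') => [over_ok|over_fail]; last first.
  by split; rewrite ?subset_setC1.
move=> S; rewrite subset_setC1 => jS; split.
  exact: under_strongest under_ok.
exact: over_strongest over_ok.
Qed.

(** With [m = n - 1] and [k = trunc_log 2 n + 1], sorting costs at most
    [m * k], the two splits and the subtraction [2 * m + 1], and the two tests
    [3 * m + 4] and [4 * m + 9]; since [n <= n * k], the sum [m * k + 9 * m + 14]
    is at most [15 * n * k]. *)
Lemma algorithm1_cost :
  (cost (algorithm1 j u0 u xj y0 y) <= 15 * (n * (trunc_log 2 n).+1))%N.
Proof.
have n0 : (0 < n)%N by case: (n) j => // -[].
rewrite /algorithm1 cost_bind.
have /cost_merge_sort_rec sort_cost :
    (size [seq t <- enum 'I_n | t != j] <= 2 ^ (trunc_log 2 n).+1)%N.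
  rewrite size_filter_neq; apply: leq_trans (leq_pred n) _.
  by apply/ltnW/trunc_log_ltn.
move: (sort_cost y (size [seq t <- enum 'I_n | t != j])).
rewrite -/(sort_desc y _) size_filter_neq => {}sort_cost.
have ssigma :
    sorted (ge_on y) (result (sort_desc y [seq t <- enum 'I_n | t != j])).
  exact: sorted_merge_sort_rec.
have := perm_size (perm_merge_sort_rec y (size [seq t <- enum 'I_n | t != j])
  [seq t <- enum 'I_n | t != j]).
rewrite -/(sort_desc y _) size_filter_neq.
move: ssigma; set sigma := result _ => ssigma sz.
rewrite cost_bind result_split_ge // cost_bind.
rewrite -[result (Defs.sub _ _)]/(y0 - y j) cost_bind result_split_ge //.
rewrite /fst /snd cost_bind cost_test_under cost_bind cost_test_over.
rewrite [cost (Ret _)]/= [cost (Defs.sub _ _)]/=.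
have := cost_split_ge y (y j) sigma.
have := cost_split_ge y (y0 - y j) sigma.
have := count_predC (fun t => y j <= y t) sigma.
have := count_size (fun t => y0 - y j <= y t) sigma.
rewrite !size_filter sz.
move: (count _ sigma) (count _ sigma) (count _ sigma) => c b a.
have := leq_trans sort_cost
  (leq_mul (leq_pred n) (leqnn (trunc_log 2 n).+1)).
have : (n <= n * (trunc_log 2 n).+1)%N by rewrite leq_pmulr.
move: (cost _) (cost _) (cost _) (n * _)%N => x1 x2 x3 p.
lia.
Qed.

End Inequalities.
End Programs.

(** * Asymptotics *)

(** [trunc_log 2 n * ln 2 <= ln n] by definition of [trunc_log], and for [n >= 2]
    the additional [ln 2] is absorbed by a second [ln n]. *)
Lemma trunc_log_le_ln (R : realType) (n : nat) : (1 < n)%N ->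
  (trunc_log 2 n).+1%:R <= 2 / ln 2 * ln n%:R :> R.
Proof.
move=> n1; have ln2 : 0 < ln 2 :> R by rewrite ln_gt0 ?ltr1n.
have k_le : (trunc_log 2 n)%:R * ln 2 <= ln n%:R :> R.
  rewrite mulr_natl -lnXn // ler_ln ?posrE ?exprn_gt0 ?ltr0n //; last by lia.
  by rewrite -natrX ler_nat trunc_logP //; lia.
have two_le : ln 2 <= ln n%:R :> R.
  by rewrite ler_ln ?posrE ?ltr0n ?ler_nat //; lia.
rewrite mulrAC ler_pdivlMr // -natr1; lra.
Qed.

Theorem theorem4 (R : realType) :
  exists T : nat -> nat,
    ((fun n : nat => (T n)%:R : R^o) =O_\oo
      (fun n : nat => n%:R * ln n%:R : R^o)) /\
    forall (n : nat) (j : 'I_n) (u0 : R) (u : 'I_n -> R),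
      0 < u0 -> (forall k, 0 <= u k) ->
      forall (xj y0 : R) (y : 'I_n -> R),
        0 <= xj <= 1 -> Y u0 u (y0, y) ->
        separates j u0 u xj y0 y (result (algorithm1 j u0 u xj y0 y)) /\
        (cost (algorithm1 j u0 u xj y0 y) <= T n)%N.
Proof.
exists (fun n => 15 * (n * (trunc_log 2 n).+1))%N; split; last first.
  move=> n j u0 u u0_gt0 u_ge0 xj y0 y _ _; split.
    exact: algorithm1_separates.
  exact: algorithm1_cost.
apply/eqOP; near=> C; near=> n.
have n1 : (1 < n)%N by near: n; exact: nbhs_infty_gt.
have lnn : 0 <= ln n%:R :> R by rewrite ln_ge0 // ler1n; lia.
rewrite ger0_norm ?ler0n // ger0_norm; last by rewrite mulr_ge0.
have C_ge : 15 * (2 / ln 2) <= C.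
  by near: C; apply: nbhs_pinfty_ge; rewrite num_real.
apply: (@le_trans _ _ (15 * (2 / ln 2) * (n%:R * ln n%:R))); last first.
  by rewrite ler_wpM2r // mulr_ge0.
rewrite !natrM -mulrA ler_pM2l ?ltr0n // mulrCA ler_wpM2l //.
exact: trunc_log_le_ln.
Unshelve. all: by end_near.
Qed.
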